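(* Let $X$ and $Y$ be two Banach spaces and let $f:X\to Y$ be a coarse Lipschitz map. The following assertions are equivalent. (i) The map $f$ is a coarse Lipschitz equivalence from $X$ to $Y$, i.e. $f\in\mathcal{CLE}(X,Y)$. (ii) There exist $A_0>0$ and $K\ge 1$ such that for all $A\ge A_0$ and all maximal $A$-separated subsets $\mathcal M$ of $X$, $\mathcal N=f(\mathcal M)$ is a net in $Y$ and $$\forall x,x'\in \mathcal M\quad \frac{1}{K}\|x-x'\|\le \|f(x)-f(x')\|\le K\|x-x'\|.$$ (iii) There exist two continuous coarse Lipschitz maps $\varphi:X\to Y$ and $\psi:Y\to X$ and a constant $C\ge 0$ such that $\|\varphi(x)-f(x)\|\le C$ for all $x\in X$ and $$\forall x\in X\ \ \|(\psi\circ \varphi)(x)-x\|\le C\quad\text{and}\quad\forall y\in Y\ \ \|(\varphi\circ \psi)(y)-y\|\le C.$$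
   Context: For a map $f$ from an unbounded metric space $(M,d)$ to a metric space $(N,\delta)$, set $Lip_s(f)=\sup\{\delta(f(x),f(x'))/d(x,x') : d(x,x')\ge s\}$ for $s>0$ and $Lip_\infty(f)=\inf_{s>0}Lip_s(f)$; $f$ is coarse Lipschitz if $Lip_\infty(f)<\infty$. A coarse Lipschitz map $f:M\to N$ between unbounded metric spaces is a coarse Lipschitz equivalence if there exist a coarse Lipschitz map $g:N\to M$ and a constant $C\ge0$ such that $d((g\circ f)(x),x)\le C$ for all $x\in M$ and $\delta((f\circ g)(y),y)\le C$ for all $y\in N$. The set of such maps is denoted $\mathcal{CLE}(M,N)$. A subset is $A$-separated if any two distinct points of it are at distance at least $A$; maximality is with respect to inclusion. For $0<a\le b$, an $(a,b)$-net in a metric space $(M,d)$ is a subset $\mathcal M\subset M$ such that $d(z,z')\ge a$ for all $z\neq z'$ in $\mathcal M$ and $d(x,\mathcal M)<b$ for every $x\in M$. A net in $M$ is a subset that is an $(a,b)$-net for some $0<a\le b$. *)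

(* Defs.v *)
From HB Require Import structures.
From mathcomp Require Import all_boot all_order all_algebra.
From mathcomp Require Import all_classical all_reals all_analysis.

Set Implicit Arguments.
Unset Strict Implicit.
Unset Printing Implicit Defensive.

Import Order.TTheory GRing.Theory Num.Theory.
Import numFieldNormedType.Exports.

Local Open Scope classical_set_scope.
Local Open Scope ring_scope.

(* The library does not make normed modules canonical instances of metricType.
   The carrier and the pseudometric (hence the topology) of normed_metric X
   are those of X. *)
Section normed_metric.
Context {R : realType} (X : normedModType R).

Let dist (x y : X) : R := `|x - y|.

Let dist_ge0 x y : 0 <= dist x y. Proof. exact: normr_ge0. Qed.

Let dist_positivity x y : dist x y = 0 -> x = y.
Proof. by move=> /normr0_eq0/eqP; rewrite subr_eq0 => /eqP. Qed.

Let ballEdist (x : X) d : ball x d = [set y | dist x y < d].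
Proof. by rewrite -ball_normE. Qed.

Definition normed_metric : metricType R :=
  HB.pack (X : Type) (PseudoMetric.class X)
    (PseudoMetric_isMetric.Build R X dist_ge0 dist_positivity ballEdist).

Lemma normed_metricE (x y : X) : @mdist R normed_metric x y = `|x - y|.
Proof. by []. Qed.

End normed_metric.

Section coarse_lipschitz.
Context {R : realType}.

(* The supremum of the empty set is -oo here. It only occurs when no two
   points of M are at distance at least s, hence never if M is unbounded. *)
Definition Lip (M N : metricType R) (s : R) (f : M -> N) : \bar R :=
  ereal_sup [set r | exists x x' : M,
    s <= mdist x x' /\ r = (mdist (f x) (f x') / mdist x x')%:E].

Definition Lip_infty (M N : metricType R) (f : M -> N) : \bar R :=
  ereal_inf [set Lip s f | s in [set s : R | 0 < s]].

Definition coarse_lipschitz (M N : metricType R) (f : M -> N) : Prop :=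
  (Lip_infty f < +oo)%E.

Definition CLE (M N : metricType R) : set (M -> N) := [set f |
  coarse_lipschitz f /\
  exists (g : N -> M) (C : R), [/\ coarse_lipschitz g, 0 <= C,
    forall x, mdist ((g \o f) x) x <= C &
    forall y, mdist ((f \o g) y) y <= C]].

End coarse_lipschitz.

Arguments Lip {R} M N s f.
Arguments Lip_infty {R} M N f.
Arguments coarse_lipschitz {R} M N f.
Arguments CLE {R} M N _.

Section nets.
Context {R : realType}.

Definition separated_set (M : metricType R) (a : R) (A : set M) : Prop :=
  forall z z', A z -> A z' -> z <> z' -> a <= mdist z z'.

Definition maximal_separated_set (M : metricType R) (a : R) (A : set M) :
    Prop :=
  separated_set a A /\
  forall B : set M, separated_set a B -> A `<=` B -> B = A.

(* equal to +oo when A is empty *)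
Definition dist_to_set (M : metricType R) (x : M) (A : set M) : \bar R :=
  ereal_inf [set (mdist x z)%:E | z in A].

Definition ab_net (M : metricType R) (a b : R) (A : set M) : Prop :=
  separated_set a A /\ forall x, (dist_to_set x A < b%:E)%E.

Definition net (M : metricType R) (A : set M) : Prop :=
  exists a b : R, [/\ 0 < a, a <= b & ab_net a b A].

End nets.

Arguments separated_set {R} M a A.
Arguments maximal_separated_set {R} M a A.
Arguments dist_to_set {R} M x A.
Arguments ab_net {R} M a b A.
Arguments net {R} M A.

(* Main.v *)
Require Import Defs.
From mathcomp Require Import all_boot all_order all_algebra.
From mathcomp Require Import finmap.
From mathcomp Require Import all_classical all_reals all_analysis.
From mathcomp Require Import wochoice lra.

Set Implicit Arguments.
Unset Strict Implicit.
Unset Printing Implicit Defensive.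

Import Order.TTheory GRing.Theory Num.Theory.
Import numFieldNormedType.Exports.

Local Open Scope classical_set_scope.
Local Open Scope ring_scope.

(** On a normed space, being coarse Lipschitz means
    |f x - f x'| <= L |x - x'| + D for all x, x': pairs at distance less than
    s are handled by going through a third point at distance at least s from
    both. With this description, (i) <-> (ii) and (i) <-> (iii) reduce to the
    triangle inequality plus two facts of a different nature.

    - A maximal A-separated set exists (Zorn) and meets every open ball of
      radius A. If g is a coarse inverse of f, then
      |x - x'| <= L' |f x - f x'| + const, and on an A-separated set with A
      large the constant is absorbed by |x - x'|; conversely, if f is
      bi-Lipschitz on a maximal separated set S and f S is a net, a coarse
      inverse sends y to a point of S whose image is near y.

    - Every map from a metric space to a normed space whose oscillation on
      balls of a fixed radius r is at most C lies within C of a continuous map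
      (continuous_approximation): average its values with a continuous
      partition of unity subordinate to the balls of radius r. Applied to f
      and to a coarse inverse of f, this turns (i) into (iii), because maps at
      bounded distance from a coarse inverse pair form such a pair again
      (quasi_inverses_close); the same lemma gives (iii) -> (i).

    In infinite dimension the partition of unity is the paracompactness of
    metric spaces. It is obtained by well-ordering the centers. The tents
    z |-> (r - d(z, x))^+ are replaced by the gains
    (tent of z - sup of the tents of the centers before z)^+, which record by
    how much z beats everything before it. At a fixed x, centers whose gains
    exceed e have tents at x that increase by more than e from one to the
    next, so there are finitely many of them. Hence the part of the gain
    exceeding half of the largest gain at x defines a locally finite family of
    continuous functions, and one of them is positive at x. *)

(** * Real-valued Lipschitz functions on a metric space *)

(** The one-sided inequality is equivalent to the two-sided one, since x and y
    can be exchanged, and it is the form that passes to suprema. *)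
Definition lipschitz_real {R : realType} {M : metricType R} (c : R)
    (u : M -> R) :=
  forall x y, u x <= u y + c * mdist x y.

Section lipschitz_real.
Context {R : realType} {M : metricType R}.
Implicit Types (c : R) (u v : M -> R).

Lemma lipschitz_real_continuous c u : lipschitz_real c u -> continuous u.
Proof.
move=> uc x; apply/cvgrPdist_le => e e0.
have c0 : 0 < `|c| + 1 by rewrite ltr_wpDl.
apply: filterS (nbhsx_ballx x _ (divr_gt0 e0 c0)) => y.
rewrite ballEmdist /= => /ltW; rewrite ler_pdivlMr// => xy.
have cd : c * mdist x y <= mdist x y * (`|c| + 1).
  rewrite mulrC ler_wpM2l ?mdist_ge0//.
  by rewrite (le_trans (ler_norm c))// lerDl.
rewrite ler_norml; apply/andP; split.
  by have := uc y x; rewrite metric_sym; lra.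
by have := uc x y; lra.
Qed.

Lemma lipschitz_real_cst c a : 0 <= c -> @lipschitz_real R M c (fun=> a).
Proof. by move=> c0 x y; rewrite lerDl mulr_ge0 ?mdist_ge0. Qed.

Lemma lipschitz_realB c c' u v : lipschitz_real c u -> lipschitz_real c' v ->
  lipschitz_real (c + c') (fun x => u x - v x).
Proof.
move=> uc vc x y; have := uc x y; have := vc y x.
by rewrite (metric_sym y x); lra.
Qed.

Lemma lipschitz_realM c u a : 0 <= a -> lipschitz_real c u ->
  lipschitz_real (a * c) (fun x => a * u x).
Proof. by move=> a0 uc x y; rewrite -mulrA -mulrDr ler_wpM2l. Qed.

Lemma lipschitz_real_max0 c u : 0 <= c -> lipschitz_real c u ->
  lipschitz_real c (fun x => Num.max 0 (u x)).
Proof.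
move=> c0 uc x y; have cd : 0 <= c * mdist x y by rewrite mulr_ge0 ?mdist_ge0.
rewrite ge_max; apply/andP; split.
  by rewrite addr_ge0// le_max lexx.
by rewrite (le_trans (uc x y))// lerD2r le_max lexx orbT.
Qed.

Lemma lipschitz_real_sup {I : Type} (u : I -> M -> R) c b :
  (forall i x, u i x <= b) -> (forall i, lipschitz_real c (u i)) -> I ->
  lipschitz_real c (fun x => sup (range (u ^~ x))).
Proof.
move=> ub uc i x y; apply: ge_sup; first by exists (u i x), i.
move=> _ [j _ <-]; rewrite (le_trans (uc j x y))// lerD2r.
by apply: ub_le_sup; [exists b => _ [k _ <-]|exists j].
Qed.

End lipschitz_real.

(** * Locally finite partitions of unity on metric spaces *)

Section partition_of_unity.
Context {R : realType} {M : metricType R} (r : R) (r0 : 0 < r).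
Context (W : rel M) (W_wo : well_order W).
Implicit Types (x y z w : M).

Definition tent z x : R := Num.max 0 (r - mdist z x).

Lemma tent_ge0 z x : 0 <= tent z x.
Proof. by rewrite le_max lexx. Qed.

Lemma tent_le z x : tent z x <= r.
Proof. by rewrite ge_max (ltW r0) gerBl mdist_ge0. Qed.

Lemma tent_gt0 z x : (0 < tent z x) = (mdist z x < r).
Proof. by rewrite lt_max ltxx subr_gt0. Qed.

Lemma tent_lipschitz z : lipschitz_real 1 (tent z).
Proof.
apply: lipschitz_real_max0 => // x y; rewrite mul1r.
by have := metric_triangle z x y; rewrite (metric_sym x y); lra.
Qed.

(** The value 0 at the centers that do not precede z keeps the family indexed
    by all of M, hence nonempty, even when z is the first center; it does not
    change the supremum otherwise, as tents are nonnegative. *)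
Definition tent_below z w x : R :=
  if W w z && (w != z) then tent w x else 0.

Lemma tent_below_le z w x : tent_below z w x <= r.
Proof. by rewrite /tent_below; case: ifP => _; rewrite ?tent_le ?ltW. Qed.

Definition sup_before z x : R := sup (range (tent_below z ^~ x)).

(** Tents take values in [0, r], so the supremum in sup_before is that of a
    bounded set and is really an upper bound. *)
Lemma tent_le_sup_before z w x : W w z -> w != z -> tent w x <= sup_before z x.
Proof.
move=> wz wNz; apply: ub_le_sup.
  by exists r => _ [v _ <-]; exact: tent_below_le.
by exists w => //; rewrite /tent_below wz wNz.
Qed.

Lemma sup_before_ge0 z x : 0 <= sup_before z x.
Proof.
apply: ub_le_sup; first by exists r => _ [v _ <-]; exact: tent_below_le.
by exists z => //; rewrite /tent_below eqxx andbF.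
Qed.

Lemma sup_before_lipschitz z : lipschitz_real 1 (sup_before z).
Proof.
apply: (@lipschitz_real_sup _ _ _ (tent_below z) 1 r _ _ z).
  exact: tent_below_le.
move=> w x y; rewrite /tent_below.
by case: ifP => _; [exact: tent_lipschitz|exact: lipschitz_real_cst].
Qed.

Definition gain z x : R := Num.max 0 (tent z x - sup_before z x).

Lemma gain_le_tent z x : gain z x <= tent z x.
Proof. by rewrite ge_max tent_ge0 gerBl sup_before_ge0. Qed.

Lemma gain_le z x : gain z x <= r.
Proof. exact: le_trans (gain_le_tent z x) (tent_le z x). Qed.

Lemma gain_lipschitz z : lipschitz_real 2 (gain z).
Proof.
apply: lipschitz_real_max0 => //; rewrite (_ : 2 = 1 + 1)//.
by apply: lipschitz_realB; [exact: tent_lipschitz|exact: sup_before_lipschitz].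
Qed.

(** If w precedes z and z has gain more than e at x, then the tent of z exceeds
    the tent of w by more than e at x. So on the centers of gain more than e
    the integer part of tent / e is injective, and it is at most r / e. *)
Lemma finite_gain_gt e x : 0 < e -> finite_set [set z | e < gain z x].
Proof.
move=> e0; set A := [set z | _].
pose level z := Num.truncn (tent z x / e).
have level_lt w z : A w -> A z -> W w z -> w != z -> (level w < level z)%N.
  move=> _ + wz wNz; rewrite /A/= /gain lt_max ltNge ltW//= => ez.
  have tw : 0 <= tent w x / e by rewrite divr_ge0 ?tent_ge0// ltW.
  have lw : (level w)%:R <= tent w x / e by rewrite truncn_le.
  have twz := tent_le_sup_before x wz wNz.
  rewrite truncn_ge_nat ?divr_ge0 ?tent_ge0 ?(ltW e0)// -natr1.
  apply: le_trans (lerD lw (lexx 1)) _.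
  by rewrite ler_pdivlMr// mulrDl mul1r divfK ?gt_eqF//; lra.
have level_inj : {in A &, injective level}.
  move=> w z /set_mem Aw /set_mem Az /eqP wz; apply/eqP/negPn/negP => wNz.
  have /orP[Wwz|Wzw] : W w z || W z w.
    by apply: (@wo_chainW _ W predT) => // B _; exact: W_wo.
    by move: (level_lt _ _ Aw Az Wwz wNz); rewrite ltn_neqAle wz.
  rewrite eq_sym in wz; rewrite eq_sym in wNz.
  by move: (level_lt _ _ Az Aw Wzw wNz); rewrite ltn_neqAle wz.
apply: (@card_le_finite _ _ A `I_(Num.truncn (r / e)).+1); last first.
  exact: finite_II.
rewrite -(card_le_eql (inj_card_eq level_inj)); apply: subset_card_le.
move=> _ [z _ <-]; rewrite /= ltnS; apply: le_truncn.
by rewrite ler_wpM2r ?tent_le// invr_ge0 ltW.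
Qed.

Definition max_gain x : R := sup (range (gain ^~ x)).

Lemma gain_le_max z x : gain z x <= max_gain x.
Proof.
by apply: ub_le_sup; [exists r => _ [w _ <-]; exact: gain_le|exists z].
Qed.

Lemma max_gain_lipschitz : lipschitz_real 2 max_gain.
Proof.
move=> x; apply: (lipschitz_real_sup gain_le gain_lipschitz x x).
Qed.

(** At the first center z whose tent is positive at x, nothing before z
    contributes, so the gain of z is its whole tent. *)
Lemma max_gain_gt0 x : 0 < max_gain x.
Proof.
have [|z [[]]] := @W_wo [pred z | 0 < tent z x].
  by exists x; rewrite inE tent_gt0 mdistxx.
rewrite inE => tz zmin _; apply: lt_le_trans (gain_le_max z x).
suff bz : sup_before z x <= 0 by rewrite /gain lt_max; apply/orP; right; lra.
apply: ge_sup; first by exists (tent_below z z x), z.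
move=> _ [w _ <-]; rewrite /tent_below.
case: ifPn => // /andP[wz wNz]; rewrite leNgt; apply/negP => tw.
have /eqP[] := wNz; apply: (@wo_chain_antisymmetric _ W predT) => //.
  by move=> B _; exact: W_wo.
by rewrite wz zmin.
Qed.

(** Cutting at half of the largest gain, a level that varies continuously with
    x and is positive, is what makes the family locally finite while leaving at
    least one peak positive at every point. *)
Definition peak z x : R := Num.max 0 (gain z x - 2^-1 * max_gain x).

Lemma peak_ge0 z x : 0 <= peak z x.
Proof. by rewrite le_max lexx. Qed.

Lemma peak_gt0 z x : (0 < peak z x) = (2^-1 * max_gain x < gain z x).
Proof. by rewrite /peak lt_max ltxx subr_gt0. Qed.

Lemma peak_support z x : peak z x != 0 -> mdist z x < r.
Proof.
rewrite -tent_gt0 => bz; apply: lt_le_trans (gain_le_tent z x).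
have : 0 < peak z x by rewrite lt_neqAle eq_sym bz peak_ge0.
by rewrite peak_gt0; have := max_gain_gt0 x; lra.
Qed.

Lemma peak_continuous z : continuous (peak z).
Proof.
apply: (@lipschitz_real_continuous _ _ (2 + 2^-1 * 2)).
apply: lipschitz_real_max0; first lra.
apply: lipschitz_realB; first exact: gain_lipschitz.
by apply: lipschitz_realM; [lra|exact: max_gain_lipschitz].
Qed.

(** A positive peak at y has gain more than half of the largest gain at y. All
    the functions involved are 2-Lipschitz, so if y is close to x the same
    center has gain more than a quarter of the largest gain H at x, and this
    leaves finitely many centers. *)
Lemma peak_locally_finite x : exists F : set M, finite_set F /\
  \forall y \near x, forall z, ~ F z -> peak z y = 0.
Proof.
have H0 := max_gain_gt0 x.
exists [set z | 4^-1 * max_gain x < gain z x]; split.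
  by apply: finite_gain_gt; lra.
(* Moving by d < H / 12 costs 2 d / 2 on half of the largest gain and 2 d on the
   gain, in total at most H / 4 = H / 2 - H / 4. *)
have d0 : 0 < max_gain x / 12 by lra.
apply: filterS (nbhsx_ballx x _ d0) => y; rewrite ballEmdist /= => xy z.
move=> /negP; rewrite -leNgt => gx; apply/eqP; rewrite eq_le peak_ge0 andbT.
rewrite leNgt peak_gt0 -leNgt.
have := gain_lipschitz z y x; have := max_gain_lipschitz x y.
by rewrite (metric_sym y x); lra.
Qed.

Lemma exists_peak_gt0 x : exists z, 0 < peak z x.
Proof.
have H0 := max_gain_gt0 x.
have [||_ [z _ <-] zx] := @sup_gt _ (range (gain ^~ x)) (2^-1 * max_gain x).
- by exists (gain x x), x.
- by rewrite -/(max_gain x); lra.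
by exists z; rewrite peak_gt0.
Qed.

End partition_of_unity.

Definition locally_finite_family {R : realType} {T : topologicalType} {I : Type}
    {V : normedModType R} (u : I -> T -> V) :=
  forall x : T, exists F : set I, finite_set F /\
    \forall y \near x, forall i, ~ F i -> u i y = 0.

Lemma continuous_locally_finite_sum {R : realType} {T : topologicalType}
    {I : choiceType} {V : normedModType R} (u : I -> T -> V) :
  locally_finite_family u -> (forall i, continuous (u i)) ->
  continuous (fun x => \sum_(i \in [set: I]) u i x).
Proof.
move=> ufin uc x; have [F [Ffin nearF]] := ufin x.
have sumE y : (forall i, ~ F i -> u i y = 0) ->
    \sum_(i \in [set: I]) u i y = \sum_(i <- fset_set F) u i y.
  move=> uF; rewrite -fsbig_finite//; apply/esym/fsbig_widen => // i [_ Fi].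
  exact: uF.
rewrite /continuous_at sumE; last exact: nbhs_singleton nearF.
apply: (@cvg_trans _ (\sum_(i <- fset_set F) u i y @[y --> x])).
  apply: near_eq_cvg; apply: filterS nearF => y uF; exact/esym/sumE.
apply: cvg_big => [|i _]; last exact: uc.
exact: add_continuous.
Qed.

(** The peaks divided by their sum. *)
Theorem metric_partition_of_unity {R : realType} {M : metricType R} (r : R) :
  0 < r -> exists p : M -> M -> R,
  [/\ locally_finite_family (p : M -> M -> R^o),
      forall z, continuous (p z), forall z x, 0 <= p z x,
      forall z x, p z x != 0 -> mdist z x < r &
      forall x, \sum_(z \in [set: M]) p z x = 1].
Proof.
move=> r0; have [W W_wo] := well_ordering_principle M.
pose b := peak r W; pose S x := \sum_(z \in [set: M]) b z x.
have b_fin : locally_finite_family (b : M -> M -> R^o).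
  by move=> x; exact: peak_locally_finite.
have Sc : continuous S.
  apply: (continuous_locally_finite_sum b_fin) => z.
  exact: peak_continuous.
have b_supp x : finite_set [set z | b z x != 0].
  have [F [Ffin /nbhs_singleton bF]] := b_fin x.
  by apply: sub_finite_set Ffin => z /= /eqP; apply: contra_notP => /bF.
have sumE x (g : M -> R) : (forall z, b z x = 0 -> g z = 0) ->
    \sum_(z \in [set: M]) g z = \sum_(z <- fset_set [set z | b z x != 0]) g z.
  move=> bg; rewrite -fsbig_finite//; apply/esym/fsbig_widen => // z [_ /=].
  by move/negP; rewrite negbK => /eqP; exact: bg.
have S0 x : 0 < S x.
  have [z bz] := exists_peak_gt0 r0 W_wo x.
  rewrite /S (sumE x)// lt_neqAle sumr_ge0 ?andbT; last first.
    by move=> *; exact: peak_ge0.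
  rewrite eq_sym psumr_neq0; last by move=> *; exact: peak_ge0.
  apply/hasP; exists z => //.
  by rewrite in_fset_set// inE/= gt_eqF.
exists (fun z x => b z x / S x); split.
- move=> x; have [F [Ffin bF]] := b_fin x; exists F; split=> //.
  by apply: filterS bF => y bF z /bF ->; rewrite mul0r.
- move=> z x; apply: cvgM; first exact: peak_continuous.
  by apply: cvgV; [rewrite gt_eqF|exact: Sc].
- by move=> z x; rewrite divr_ge0 ?peak_ge0// ltW.
- move=> z x; rewrite mulf_eq0 negb_or => /andP[bz _].
  exact: (peak_support r0 W_wo).
- move=> x; rewrite (sumE x) => [|z ->]; last by rewrite mul0r.
  rewrite -mulr_suml -(sumE x (b ^~ x))//.
  by rewrite -[X in X / _]/(S x) divff ?gt_eqF.
Qed.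

(** The approximation at x is a convex combination of the values f z at centers
    z with d(z, x) < r, each within C of f x. *)
Theorem continuous_approximation {R : realType} {M : metricType R}
    {V : normedModType R} (f : M -> V) (r C : R) :
  0 < r -> (forall x z, mdist z x < r -> `|f z - f x| <= C) ->
  exists2 phi : M -> V, continuous phi & forall x, `|phi x - f x| <= C.
Proof.
move=> r0 fC.
have [p [p_fin pc p0 p_supp p1]] := @metric_partition_of_unity R M r r0.
exists (fun x => \sum_(z \in [set: M]) p z x *: f z).
  apply: continuous_locally_finite_sum => [x|z x].
    have [F [Ffin pF]] := p_fin x; exists F; split=> //.
    by apply: filterS pF => y pF z /pF ->; rewrite scale0r.
  by apply: cvgZr_tmp; exact: pc.
move=> x; have [F [Ffin /nbhs_singleton pF]] := p_fin x.
have sumE (U : nmodType) (g : M -> U) : (forall z, p z x = 0 -> g z = 0) ->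
    \sum_(z \in [set: M]) g z = \sum_(z <- fset_set F) g z.
  move=> pg; rewrite -fsbig_finite//; apply/esym/fsbig_widen => // z [_ Fz].
  exact/pg/pF.
have p1F : \sum_(z <- fset_set F) p z x = 1 by rewrite -sumE.
rewrite sumE => [|z ->]; last by rewrite scale0r.
rewrite -[X in _ - X]scale1r -p1F scaler_suml -sumrB.
rewrite -[leRHS]mul1r -p1F mulr_suml.
apply: le_trans (ler_norm_sum _ _ _) _; apply: ler_sum => z _.
rewrite -scalerBr normrZ ger0_norm//.
have [->|pz] := eqVneq (p z x) 0; first by rewrite !mul0r.
by rewrite ler_wpM2l// fC// p_supp.
Qed.

(** * Coarse Lipschitz maps between normed spaces *)

Definition large_scale_lipschitz {R : realType} {X Y : normedModType R}
    (L D : R) (f : X -> Y) :=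
  forall x x', `|f x - f x'| <= L * `|x - x'| + D.

Lemma large_scale_lipschitz_coarse {R : realType} {X Y : normedModType R}
    (L D : R) (f : X -> Y) : 0 <= D -> large_scale_lipschitz L D f ->
  coarse_lipschitz (normed_metric X) (normed_metric Y) f.
Proof.
move=> D0 fLD.
apply: (@le_lt_trans _ _ (Lip (normed_metric X) (normed_metric Y) 1 f)).
  apply: ereal_inf_lbound; exists 1 => //=; exact: ltr01.
apply: (@le_lt_trans _ _ (L + D)%:E); last by rewrite ltry.
apply: ge_ereal_sup => _ [x [x' [+ ->]]].
rewrite !normed_metricE => xx'; rewrite lee_fin.
rewrite ler_pdivrMr; last exact: lt_le_trans xx'.
by rewrite (le_trans (fLD x x'))// mulrDl lerD2l ler_peMr.
Qed.

(** The converse of large_scale_lipschitz_coarse uses the linear structure of X: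
    points at distance less than s are joined through a point z that is at
    distance 2 s from x, hence at distance between s and 3 s from x'. The
    resulting bound 2 s L + 3 s L is the additive constant. *)
Lemma coarse_lipschitz_large_scale {R : realType} {X Y : normedModType R}
    (f : X -> Y) : coarse_lipschitz (normed_metric X) (normed_metric Y) f ->
  exists L D : R, [/\ 0 <= L, 0 <= D & large_scale_lipschitz L D f].
Proof.
move=> /ereal_inf_lt[_ [s /= s0 <-] Lip_fin].
have [L L0 fL] : exists2 L : R, 0 <= L &
    forall x x', s <= `|x - x'| -> `|f x - f x'| <= L * `|x - x'|.
  exists (Num.max 0 (fine (Lip (normed_metric X) (normed_metric Y) s f))).
    by rewrite le_max lexx.
  move=> x x' sx; have x0 := lt_le_trans s0 sx.
  rewrite -ler_pdivrMr// le_max; apply/orP; right.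
  have Lx : ((`|f x - f x'| / `|x - x'|)%:E <=
             Lip (normed_metric X) (normed_metric Y) s f)%E.
    by apply: ereal_sup_ubound; exists x, x'.
  by case: (Lip (normed_metric X) (normed_metric Y) s f) Lx Lip_fin.
exists L, (5 * L * s); split=> //; first by rewrite !mulr_ge0// ltW.
move=> x x'; have [sx|xs] := leP s `|x - x'|.
  by rewrite (le_trans (fL x x' sx))// lerDl !mulr_ge0// ltW.
have [[e e0]|X0] := pselect (exists e : X, e != 0).
  pose z := x + (2 * s / `|e|) *: e.
  have xz : `|x - z| = 2 * s.
    rewrite /z opprD addNKr normrN normrZ normrM normfV normr_id.
    by rewrite divfK ?normr_eq0// ger0_norm// mulr_ge0// ltW.
  have zx1 : s <= `|z - x'|.
    have := ler_distD x' x z; rewrite xz (distrC x' z); lra.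
  have zx2 : `|z - x'| <= 3 * s.
    have := ler_distD x z x'; rewrite (distrC z x) xz; lra.
  have := ler_distD (f z) (f x) (f x').
  have := fL x z; rewrite xz => /(_ ltac:(lra)).
  have := fL z x' zx1.
  have := ler_wpM2l L0 zx2.
  have : 0 <= L * `|x - x'| by rewrite mulr_ge0.
  by nra.
(* X is the zero space. *)
have -> : x = x'.
  apply/eqP; rewrite -subr_eq0; apply/negPn/negP => xx'.
  by apply: X0; exists (x - x').
by rewrite subrr normr0 addr_ge0// !mulr_ge0// ltW.
Qed.

Lemma large_scale_lipschitz_close {R : realType} {X Y : normedModType R}
    (L D C : R) (f g : X -> Y) : large_scale_lipschitz L D f ->
  (forall x, `|g x - f x| <= C) -> large_scale_lipschitz L (D + 2 * C) g.
Proof.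
move=> fLD gf x x'.
have := ler_distD (f x) (g x) (g x'); have := ler_distD (f x') (f x) (g x').
by have := fLD x x'; have := gf x; have := gf x'; rewrite (distrC (g x')); lra.
Qed.

Lemma continuous_approx_large_scale {R : realType} {X Y : normedModType R}
    (L D : R) (f : X -> Y) : 0 <= L -> large_scale_lipschitz L D f ->
  exists2 phi : X -> Y, continuous phi & forall x, `|phi x - f x| <= L + D.
Proof.
move=> L0 fLD.
apply: (@continuous_approximation R (normed_metric X) Y f 1 (L + D)) => // x z.
rewrite normed_metricE => /ltW xz; rewrite (le_trans (fLD z x))//.
by rewrite lerD2r ler_piMr.
Qed.

(** * Maximal separated sets *)

(** Otherwise x could be added to S. *)
Lemma maximal_separated_dense {R : realType} {M : metricType R} (A : R)
    (S : set M) (x : M) : 0 < A -> maximal_separated_set M A S ->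
  exists2 m, S m & mdist x m < A.
Proof.
move=> A0 [Ssep Smax]; apply: contrapT => xS.
have far m : S m -> A <= mdist x m.
  by move=> Sm; rewrite leNgt; apply/negP => xm; apply: xS; exists m.
have Sx : S x.
  rewrite -(Smax (S `|` [set x])); [by right| |by left].
  move=> z z' [Sz|->] [Sz'|->] zz' //.
  - exact: Ssep.
  - by rewrite metric_sym; exact: far.
  - exact: far.
by have := far x Sx; rewrite mdistxx leNgt A0.
Qed.

Lemma maximal_separated_exists {R : realType} (M : metricType R) (A : R) :
  exists S, maximal_separated_set M A S.
Proof.
have [F FA Ftot|S [Ssep Smax]] := @Zorn_bigcup M (separated_set M A).
  move=> z z' [S FS Sz] [S' FS' Sz'].
  by have [SS'|S'S] := Ftot _ _ FS FS';
    [apply: (FA _ FS') => //; exact: SS'|apply: (FA _ FS) => //; exact: S'S].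
exists S; split=> // B Bsep SB; apply: contrapT => BS.
by apply: (Smax B) => //; split=> // BS'; apply: BS; exact/seteqP.
Qed.

(** * Coarse inverses and bi-Lipschitz behaviour on nets *)

Section bilipschitz_on_nets.
Context {R : realType} {X Y : normedModType R} (f : X -> Y) (L D : R).

Definition quasi_inverses (phi : X -> Y) (psi : Y -> X) (C : R) :=
  (forall x, `|psi (phi x) - x| <= C) /\ (forall y, `|phi (psi y) - y| <= C).

Definition bilipschitz_on_nets (A0 K : R) :=
  forall A, A0 <= A -> forall S, maximal_separated_set (normed_metric X) A S ->
    net (normed_metric Y) (f @` S) /\
    forall x x', S x -> S x' ->
      K^-1 * `|x - x'| <= `|f x - f x'| /\ `|f x - f x'| <= K * `|x - x'|.

(** The constant A0 is chosen so that the error 2 C + D' in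
    |x - x'| <= L' |f x - f x'| + 2 C + D' is at most |x - x'| / 2 for distinct
    points of an A-separated set; since also |x - x'| >= 1, the additive
    constant of f is absorbed in the other direction. The images are then
    A / K separated, and y is near f m for any m in the set close to g y. *)
Lemma quasi_inverse_bilipschitz_on_nets (g : Y -> X) (L' D' C : R) :
  0 <= L -> 0 <= D -> large_scale_lipschitz L D f ->
  0 <= L' -> 0 <= D' -> large_scale_lipschitz L' D' g -> 0 <= C ->
  quasi_inverses f g C ->
  exists A0 K, [/\ 0 < A0, 1 <= K & bilipschitz_on_nets A0 K].
Proof.
move=> L0 D0 f_lip L'0 D'0 g_lip C0 [gf fg].
pose A0 := 1 + 2 * (2 * C + D'); pose K := 1 + L + D + 2 * L'.
exists A0, K; split; [by rewrite /A0; lra|by rewrite /K; lra|].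
have K0 : 0 < K by rewrite /K; lra.
move=> A A0A S Smax; have A1 : 1 <= A by rewrite /A0 in A0A; lra.
have bilip x x' : S x -> S x' ->
    K^-1 * `|x - x'| <= `|f x - f x'| /\ `|f x - f x'| <= K * `|x - x'|.
  move=> Sx Sx'; have [->|/eqP xx'] := eqVneq x x'.
    by rewrite !subrr !normr0 !mulr0.
  have Ax : A <= `|x - x'| := Smax.1 x x' Sx Sx' xx'.
  split; last first.
    rewrite (le_trans (f_lip x x'))// /K.
    have := mulr_ge0 L'0 (normr_ge0 (x - x')); nra.
  rewrite mulrC ler_pdivrMr//.
  have := ler_distD (g (f x)) x x'; have := ler_distD (g (f x')) (g (f x)) x'.
  have := gf x; have := gf x'; rewrite (distrC _ x).
  have := g_lip (f x) (f x'); have := normr_ge0 (f x - f x').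
  rewrite /K; rewrite /A0 in A0A.
  have := mulr_ge0 L0 (normr_ge0 (f x - f x')).
  have := mulr_ge0 D0 (normr_ge0 (f x - f x')).
  nra.
split=> //; exists (A / K), (A + L * A + D + C + 1); split.
- by rewrite divr_gt0//; lra.
- have : A / K <= A by rewrite ler_pdivrMr// ler_peMr /K; lra.
  have : 0 <= L * A by rewrite mulr_ge0//; lra.
  by lra.
split=> [_ _ [x Sx <-] [x' Sx' <-] fxx'|y].
  rewrite normed_metricE; apply: le_trans (bilip x x' Sx Sx').1.
  rewrite mulrC ler_pM2l ?invr_gt0//.
  by apply: Smax.1 => // xx'; rewrite xx' in fxx'.
have [|m Sm ym] :=
  @maximal_separated_dense _ (normed_metric X) A S (g y) _ Smax; first lra.
rewrite normed_metricE in ym.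
apply: (@le_lt_trans _ _ (`|y - f m|)%:E).
  by apply: ereal_inf_lbound; exists (f m); [exists m|].
rewrite lte_fin.
have := ler_distD (f (g y)) y (f m); have := fg y; rewrite (distrC _ y).
have := f_lip (g y) m; have := ler_wpM2l L0 (ltW ym); lra.
Qed.

(** The coarse inverse picks, for each y, a point of one maximal A0-separated
    set whose image is within b of y, where b is the covering radius of the
    image net. It is Lipschitz up to a constant because f multiplies distances
    by at least 1 / K on that set, and g (f x) is compared with x through a point
    of the set close to x. *)
Lemma bilipschitz_on_nets_quasi_inverse (A0 K : R) :
  0 <= L -> 0 <= D -> large_scale_lipschitz L D f -> 0 < A0 -> 1 <= K ->
  bilipschitz_on_nets A0 K ->
  exists (g : Y -> X) (D' C : R), [/\ 0 <= D', 0 <= C,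
    large_scale_lipschitz K D' g & quasi_inverses f g C].
Proof.
move=> L0 D0 f_lip A00 K1 fK.
have [S Smax] := maximal_separated_exists (normed_metric X) A0.
have [[a [b [a0 ab [_ fSb]]]] bilip] := fK A0 (lexx _) S Smax.
have K0 : 0 < K by lra.
have b0 : 0 < b by lra.
have lower x x' : S x -> S x' -> `|x - x'| <= K * `|f x - f x'|.
  by move=> Sx Sx'; rewrite -ler_pdivrMl//; exact: (bilip x x' Sx Sx').1.
have /choice[g gP] : forall y, exists m, S m /\ `|y - f m| < b.
  by move=> y; have [_ [_ [m Sm <-] <-] ym] := ereal_inf_lt (fSb y); exists m.
have gS y := (gP y).1; have fg y := (gP y).2.
exists g, (K * (2 * b)), (b + A0 + K * (b + L * A0 + D)); split.
- by rewrite !mulr_ge0//; lra.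
- by rewrite !addr_ge0 ?mulr_ge0 ?addr_ge0 ?mulr_ge0//; lra.
- move=> y y'; rewrite (le_trans (lower _ _ (gS y) (gS y')))// -mulrDr.
  rewrite ler_pM2l//.
  have := ler_distD y (f (g y)) (f (g y')); have := ler_distD y' y (f (g y')).
  by have := fg y; have := fg y'; rewrite (distrC y (f (g y))); lra.
have KC : 0 <= K * (b + L * A0 + D).
  by rewrite mulr_ge0 ?addr_ge0 ?mulr_ge0//; lra.
split=> [x|y]; last by rewrite distrC; have := fg y; lra.
have [m Sm xm] := @maximal_separated_dense _ (normed_metric X) A0 S x A00 Smax.
rewrite normed_metricE in xm.
have := ler_distD m (g (f x)) x; rewrite (distrC m x).
have := lower _ _ (gS (f x)) Sm.
suff : `|f (g (f x)) - f m| <= b + L * A0 + D.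
  by move=> /(ler_wpM2l (ltW K0)); lra.
have := ler_distD (f x) (f (g (f x))) (f m); have := fg (f x).
rewrite (distrC (f x) (f (g (f x)))).
by have := f_lip x m; have := ler_wpM2l L0 (ltW xm); lra.
Qed.

End bilipschitz_on_nets.


(** * Perturbation of coarse inverses, and the equivalences *)

Lemma quasi_inverses_close {R : realType} {X Y : normedModType R}
    (f phi : X -> Y) (g psi : Y -> X) (L D L' D' E E' C : R) :
  0 <= L -> large_scale_lipschitz L D f ->
  0 <= L' -> large_scale_lipschitz L' D' g ->
  (forall x, `|phi x - f x| <= E) -> (forall y, `|psi y - g y| <= E') ->
  quasi_inverses f g C ->
  quasi_inverses phi psi (E' + (L' * E + D') + (E + (L * E' + D)) + C).
Proof.
move=> L0 f_lip L'0 g_lip fE gE [gf fg].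
have [E0 E'0] : 0 <= E /\ 0 <= E'.
  by split; [exact: le_trans (fE 0)|exact: le_trans (gE 0)].
have D0 : 0 <= D by have := f_lip 0 0; rewrite !subrr !normr0 mulr0 add0r.
have D'0 : 0 <= D' by have := g_lip 0 0; rewrite !subrr !normr0 mulr0 add0r.
have LE' := mulr_ge0 L0 E'0; have L'E := mulr_ge0 L'0 E0.
split=> [x|y].
  have := ler_distD (g (phi x)) (psi (phi x)) x.
  have := ler_distD (g (f x)) (g (phi x)) x.
  have := gE (phi x); have := gf x; have := g_lip (phi x) (f x).
  by have := ler_wpM2l L'0 (fE x); lra.
have := ler_distD (f (psi y)) (phi (psi y)) y.
have := ler_distD (f (g y)) (f (psi y)) y.
have := fE (psi y); have := fg y; have := f_lip (psi y) (g y).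
by have := ler_wpM2l L0 (gE y); lra.
Qed.

Theorem proposition3p3 (R : realType) (X Y : completeNormedModType R)
    (f : X -> Y) (f_cl : coarse_lipschitz (normed_metric X) (normed_metric Y) f) :
  let assertion_i := CLE (normed_metric X) (normed_metric Y) f in
  let assertion_ii :=
    exists A0 K : R, [/\ 0 < A0, 1 <= K &
      forall A : R, A0 <= A ->
      forall M : set X, maximal_separated_set (normed_metric X) A M ->
        net (normed_metric Y) (f @` M) /\
        forall x x' : X, M x -> M x' ->
          K^-1 * `|x - x'| <= `|f x - f x'| /\
          `|f x - f x'| <= K * `|x - x'|] in
  let assertion_iii :=
    exists (phi : X -> Y) (psi : Y -> X) (C : R),
      [/\ continuous phi /\ continuous psi,
          coarse_lipschitz (normed_metric X) (normed_metric Y) phi /\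
          coarse_lipschitz (normed_metric Y) (normed_metric X) psi,
          0 <= C /\ (forall x : X, `|phi x - f x| <= C),
          forall x : X, `|(psi \o phi) x - x| <= C &
          forall y : Y, `|(phi \o psi) y - y| <= C] in
  (assertion_i <-> assertion_ii) /\ (assertion_ii <-> assertion_iii).
Proof.
move=> assertion_i assertion_ii assertion_iii.
have [L [D [L0 D0 f_lip]]] := coarse_lipschitz_large_scale f_cl.
have i_ii : assertion_i <-> assertion_ii.
  split=> [[_ [g [C [g_cl C0 gf fg]]]]|[A0 [K [A00 K1 fK]]]].
    have [L' [D' [L'0 D'0 g_lip]]] := coarse_lipschitz_large_scale g_cl.
    exact: (quasi_inverse_bilipschitz_on_nets L0 D0 f_lip L'0 D'0 g_lip C0
             (conj gf fg)).
  have [g [D' [C [D'0 C0 g_lip [gf fg]]]]] :=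
    bilipschitz_on_nets_quasi_inverse L0 D0 f_lip A00 K1 fK.
  split=> //; exists g, C; split=> //.
  exact: large_scale_lipschitz_coarse D'0 g_lip.
have i_iii : assertion_i <-> assertion_iii.
  split=> [[_ [g [C [g_cl C0 gf fg]]]]|].
    have [L' [D' [L'0 D'0 g_lip]]] := coarse_lipschitz_large_scale g_cl.
    have [phi phic phif] := continuous_approx_large_scale L0 f_lip.
    have [psi psic psig] := continuous_approx_large_scale L'0 g_lip.
    set E := L + D in phif; set E' := L' + D' in psig.
    have E0 : 0 <= E by rewrite addr_ge0.
    have E'0 : 0 <= E' by rewrite addr_ge0.
    have [psiphi phipsi] :=
      quasi_inverses_close L0 f_lip L'0 g_lip phif psig (conj gf fg).
    have LE' := mulr_ge0 L0 E'0; have L'E := mulr_ge0 L'0 E0.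
    exists phi, psi, (E' + (L' * E + D') + (E + (L * E' + D)) + C).
    split=> //; last by split=> [|x]; [lra|have := phif x; lra].
    split.
      apply: (large_scale_lipschitz_coarse _
        (large_scale_lipschitz_close f_lip phif)); lra.
    apply: (large_scale_lipschitz_coarse _
      (large_scale_lipschitz_close g_lip psig)); lra.
  move=> [phi [psi [C [_ [phi_cl psi_cl] [C0 phif] psiphi phipsi]]]].
  have [L1 [D1 [L10 D10 phi_lip]]] := coarse_lipschitz_large_scale phi_cl.
  have [L2 [D2 [L20 D20 psi_lip]]] := coarse_lipschitz_large_scale psi_cl.
  have fphi x : `|f x - phi x| <= C by rewrite distrC.
  have psipsi y : `|psi y - psi y| <= 0 by rewrite subrr normr0.
  have [psif fpsi] := quasi_inverses_close L10 phi_lip L20 psi_lip fphi psipsi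
    (conj psiphi phipsi).
  split=> //; exists psi, (0 + (L2 * C + D2) + (C + (L1 * 0 + D1)) + C).
  by split=> //; rewrite mulr0; have := mulr_ge0 L20 C0; lra.
by split=> //; split=> [/i_ii/i_iii|/i_iii/i_ii].
Qed.
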